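(* RNN language models (RLMs) can simulate real-time deterministic probabilistic two-stack pushdown automata (RD-2PDA): for every RD-2PDA there exists a strongly equivalent RLM.
   Context: Alphabets are finite non-empty sets. $\varepsilon$ is the empty string, $\varepsilon\notin\Sigma$, $\Sigma_\varepsilon=\Sigma\cup\{\varepsilon\}$, $\Gamma_\varepsilon=\Gamma\cup\{\varepsilon\}$. EOS is a special end-of-string symbol and $\overline\Sigma=\Sigma\cup\{\mathrm{EOS}\}$. A probabilistic two-stack pushdown automaton (2PDA) is a two-stack machine $\mathcal{P}=(Q,\Sigma,\Gamma,\delta,q_\iota,q_\varphi)$, where $Q$ is a finite set of states, $\Sigma$ and $\Gamma$ are the input and stack alphabets, $\Gamma$ contains the bottom-of-stack symbol $\perp$, $q_\iota,q_\varphi\in Q$ are the initial and final states, and $\delta: Q\times\Gamma\times\Sigma_\varepsilon\times Q\times\Gamma_\varepsilon^4\to\mathbb{Q}_{\ge 0}$ is a transition weighting function. A transition $q\xrightarrow[\gamma_2\to\gamma_4]{y,\gamma,\ \gamma_1\to\gamma_3}q'$ means that the 2PDA, in state $q$ with $\gamma\in\Gamma$ on top of the first stack, pops $\gamma_1$ and $\gamma_2$ from the first and second stack, pushes $\gamma_3$ and $\gamma_4$ onto the first and second stack, moves to $q'$, and emits $y\in\Sigma_\varepsilon$ ($\gamma_1,\dots,\gamma_4\in\Gamma_\varepsilon$). The weights are locally normalized: for all $q\in Q,\gamma\in\Gamma$, the sum of $\delta$ over all $y,q',\gamma_1,\dots,\gamma_4$ equals $1$. The 2PDA starts in $q_\iota$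 with both stacks containing only $\perp$, sequentially applies transitions according to their probability given by $\delta$, and halts when reaching $q_\varphi$; its output is the concatenation of the emitted symbols. A 2PDA is deterministic if (i) for any current state $q$, current top symbol $\gamma$ of the first stack, and output symbol $y\in\Sigma_\varepsilon$, there is at most one transition with non-zero weight; and (ii) if, in a given computation step, the weight of an $\varepsilon$-transition (one emitting $\varepsilon$) is non-zero, then its weight is $1$ and the weight of all other transitions is $0$. A deterministic 2PDA is real-time (an RD-2PDA) if, for all $q\in Q$ and $\gamma\in\Gamma$, all $\varepsilon$-transitions have weight $0$. An RLM over $\Sigma$ consists of a simple RNN with hidden dimension $D$ and embedding dimension $R$, namely an initial hidden state $\mathbf{h}_0\in\mathbb{Q}^D$, a symbol representation function $\mathbf{r}:\Sigma\to\mathbb{Q}^R$, and parameters $\mathbf{U}\in\mathbb{Q}^{D\times D}$, $\mathbf{V}\in\mathbb{Q}^{D\times R}$, $\mathbf{b}\in\mathbb{Q}^D$, with update $\mathbf{h}_t=f(\mathbf{U}\mathbf{h}_{t-1}+\mathbf{V}\mathbf{r}(y_t)+\mathbf{b})$, where $f$ is applied componentwise and is the saturated sigmoid $f(x)=0$ for $x<0$, $f(x)=x$ for $x\in[0,1]$, $f(x)=1$ for $x>1$; together with an output matrix $\mathbf{E}\in\mathbb{Q}^{|\overline\Sigma|\times D}$ and a projection function $\boldsymbol{\pi}:\mathbb{Q}^{|\overline\Sigma|}\to\boldsymbol{\Delta}^{|\overline\Sigma|-1}$ to the probability simplex. After generating $y_1,\dots,y_t\in\Sigma$, the next symbol $y\in\overline\Sigma$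 is generated with probability $\boldsymbol{\pi}(\mathbf{E}\mathbf{h}_t)_y$ and is fed back as the next RNN input, until EOS is generated. A path of a 2PDA is a finite sequence of transitions from the initial configuration, halting if it ends in $q_\varphi$; transitions of weight $0$ are treated as non-existent. A halting path of an RLM is a finite sequence of generated symbols from $\Sigma$ followed by EOS, all generated with non-zero probability. The weight of a path is the product of the weights (probabilities) of its steps, and its yield is the string in $\Sigma^*$ it emits (dropping EOS). Two models are strongly equivalent if they assign every $\boldsymbol{y}\in\Sigma^*$ the same probability (the sum of the weights of halting paths with yield $\boldsymbol{y}$) and there is a weight-preserving, yield-preserving bijection between their halting paths. *)

(* Defs.v *)
From HB Require Import structures.
From mathcomp Require Import all_boot all_order all_algebra.
From mathcomp Require Import boolp classical_sets functions reals ereal esum.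

Set Implicit Arguments.
Unset Strict Implicit.
Unset Printing Implicit Defensive.

Import Order.TTheory GRing.Theory Num.Theory.
Local Open Scope ring_scope.

(** * Language models seen through their halting paths *)

Record language_model (R : realType) (Sigma : finType) := LanguageModel {
  lm_path : choiceType;
  lm_halting : set lm_path;
  lm_weight : lm_path -> R;
  lm_yield : lm_path -> seq Sigma }.

(* A string may have infinitely many halting paths (epsilon-transitions), so
   the sum is an unordered sum of nonnegative terms in the extended reals. *)
Definition string_prob (R : realType) (Sigma : finType)
    (M : language_model R Sigma) (y : seq Sigma) : \bar R :=
  esum [set p | @lm_halting _ _ M p /\ lm_yield p = y]%classic
       (fun p => (lm_weight p)%:E).

Definition strongly_equivalent (R : realType) (Sigma : finType)
    (M1 M2 : language_model R Sigma) : Prop :=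
  (forall y : seq Sigma, string_prob M1 y = string_prob M2 y) /\
  exists f : lm_path M1 -> lm_path M2,
    set_bij (@lm_halting _ _ M1) (@lm_halting _ _ M2) f /\
    forall p, @lm_halting _ _ M1 p ->
      lm_weight (f p) = lm_weight p /\ lm_yield (f p) = lm_yield p.

(** * Probabilistic two-stack pushdown automata *)

(* [option Sigma] and [option Gamma] are the alphabets extended with the empty
   string, which is [None]. *)
Record transition (Q Sigma Gamma : finType) := Transition {
  tsrc : Q;
  ttop : Gamma;
  tout : option Sigma;
  tdst : Q;
  tpop1 : option Gamma;
  tpop2 : option Gamma;
  tpush1 : option Gamma;
  tpush2 : option Gamma }.

Section TransitionFinite.
Variables Q Sigma Gamma : finType.

Definition transition_to_tuple (t : transition Q Sigma Gamma) :=
  (tsrc t, ttop t, tout t, tdst t, tpop1 t, tpop2 t, tpush1 t, tpush2 t).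

Definition transition_of_tuple u : transition Q Sigma Gamma :=
  let: (q, g, y, q', g1, g2, g3, g4) := u in
  Transition q g y q' g1 g2 g3 g4.

Lemma transition_to_tupleK : cancel transition_to_tuple transition_of_tuple.
Proof. by case. Qed.

HB.instance Definition _ :=
  Finite.copy (transition Q Sigma Gamma) (can_type transition_to_tupleK).

End TransitionFinite.

Record two_pda (Q Sigma Gamma : finType) := TwoPDA {
  bottom : Gamma;
  delta : transition Q Sigma Gamma -> rat;
  init_state : Q;
  final_state : Q;
  delta_ge0 : forall t, 0 <= delta t;
  delta_normalized : forall (q : Q) (g : Gamma),
    \sum_(t : transition Q Sigma Gamma | (tsrc t == q) && (ttop t == g))
      delta t = 1 }.

Section TwoPDARuns.
Variables (Q Sigma Gamma : finType) (P : two_pda Q Sigma Gamma).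

(* State, first stack, second stack; the top of a stack is its head. *)
Definition pda_config : Type := (Q * seq Gamma * seq Gamma)%type.

Definition pda_init : pda_config :=
  (init_state P, [:: bottom P], [:: bottom P]).

Definition pop (g : option Gamma) (s : seq Gamma) : option (seq Gamma) :=
  match g, s with
  | None, _ => Some s
  | Some a, b :: s' => if a == b then Some s' else None
  | Some _, [::] => None
  end.

Definition push (g : option Gamma) (s : seq Gamma) : seq Gamma :=
  if g is Some a then a :: s else s.

(* [None] when [t] cannot be taken in [c]; in particular no transition leaves
   the final state, where the automaton has halted, nor a configuration whose
   first stack is empty. *)
Definition pda_step (c : pda_config) (t : transition Q Sigma Gamma) :
    option pda_config :=
  let: (q, s1, s2) := c in
  if [&& q != final_state P, tsrc t == q, ohead s1 == Some (ttop t)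
       & delta P t != 0]
  then match pop (tpop1 t) s1, pop (tpop2 t) s2 with
       | Some s1', Some s2' =>
           Some (tdst t, push (tpush1 t) s1', push (tpush2 t) s2')
       | _, _ => None
       end
  else None.

Fixpoint pda_run (c : pda_config) (p : seq (transition Q Sigma Gamma)) :
    option pda_config :=
  if p is t :: p' then
    if pda_step c t is Some c' then pda_run c' p' else None
  else Some c.

Definition pda_halting (p : seq (transition Q Sigma Gamma)) : bool :=
  if pda_run pda_init p is Some (q, _, _) then q == final_state P else false.

Definition pda_weight (p : seq (transition Q Sigma Gamma)) : rat :=
  \prod_(t <- p) delta P t.

Definition pda_yield (p : seq (transition Q Sigma Gamma)) : seq Sigma :=
  pmap (@tout Q Sigma Gamma) p.

Definition pda_deterministic : Prop :=
  (forall t t' : transition Q Sigma Gamma,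
     tsrc t = tsrc t' -> ttop t = ttop t' -> tout t = tout t' ->
     delta P t != 0 -> delta P t' != 0 -> t = t') /\
  (forall t : transition Q Sigma Gamma,
     tout t = None -> delta P t != 0 ->
     delta P t = 1 /\
     forall t' : transition Q Sigma Gamma,
       tsrc t' = tsrc t -> ttop t' = ttop t -> t' <> t -> delta P t' = 0).

Definition pda_real_time : Prop :=
  forall t : transition Q Sigma Gamma, tout t = None -> delta P t = 0.

Definition is_RD_2PDA : Prop := pda_deterministic /\ pda_real_time.

Definition lm_of_pda (R : realType) : language_model R Sigma :=
  @LanguageModel R Sigma (seq (transition Q Sigma Gamma))
    [set p | pda_halting p]%classic
    (fun p => ratr (pda_weight p)) pda_yield.

End TwoPDARuns.

(** * RNN language models *)

Definition sat_sigmoid (x : rat) : rat :=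
  if x < 0 then 0 else if x <= 1 then x else 1.

(* [option Sigma] is here the alphabet extended with EOS, which is [None];
   coordinates of vectors over it are indexed through [enum_rank]. *)
Record rlm (R : realType) (Sigma : finType) := RLM {
  hidden_dim : nat;
  embed_dim : nat;
  rnn_h0 : 'cV[rat]_hidden_dim;
  rnn_r : Sigma -> 'cV[rat]_embed_dim;
  rnn_U : 'M[rat]_(hidden_dim, hidden_dim);
  rnn_V : 'M[rat]_(hidden_dim, embed_dim);
  rnn_b : 'cV[rat]_hidden_dim;
  rlm_E : 'M[rat]_(#|{: option Sigma}|, hidden_dim);
  rlm_proj : 'cV[rat]_#|{: option Sigma}| -> 'cV[R]_#|{: option Sigma}|;
  rlm_proj_ge0 : forall x i, 0 <= rlm_proj x i 0;
  rlm_proj_sum1 : forall x, \sum_i rlm_proj x i 0 = 1 }.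

Section RLMRuns.
Variables (R : realType) (Sigma : finType) (M : rlm R Sigma).

Definition rnn_update (h : 'cV[rat]_(hidden_dim M)) (y : Sigma) :
    'cV[rat]_(hidden_dim M) :=
  map_mx sat_sigmoid (rnn_U M *m h + rnn_V M *m rnn_r M y + rnn_b M).

Definition rlm_next_prob (h : 'cV[rat]_(hidden_dim M)) (y : option Sigma) : R :=
  rlm_proj M (rlm_E M *m h) (enum_rank y) 0.

Fixpoint rlm_halting_from (h : 'cV[rat]_(hidden_dim M)) (p : seq (option Sigma)) :
    bool :=
  match p with
  | [::] => false
  | None :: p' => (rlm_next_prob h None != 0) && (p' == [::])
  | Some y :: p' =>
      (rlm_next_prob h (Some y) != 0) && rlm_halting_from (rnn_update h y) p'
  end.

(* EOS is not fed back to the RNN, and what follows it is ignored: only the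
   value on halting paths, where nothing follows, is meaningful. *)
Fixpoint rlm_weight_from (h : 'cV[rat]_(hidden_dim M)) (p : seq (option Sigma)) :
    R :=
  match p with
  | [::] => 1
  | None :: _ => rlm_next_prob h None
  | Some y :: p' =>
      rlm_next_prob h (Some y) * rlm_weight_from (rnn_update h y) p'
  end.

Definition rlm_yield (p : seq (option Sigma)) : seq Sigma := pmap id p.

Definition lm_of_rlm : language_model R Sigma :=
  @LanguageModel R Sigma (seq (option Sigma))
    [set p | rlm_halting_from (rnn_h0 M) p]%classic
    (rlm_weight_from (rnn_h0 M)) rlm_yield.

End RLMRuns.

(* Main.v *)
(** After Siegelmann and Sontag: the stacks are encoded as rationals in a Cantor
    set, so that pushing and popping a known symbol are affine maps and the top
    of a stack is read off by differences of saturated affine functions.  To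
    simulate one step in one application of the nonlinearity, all neurons are
    replicated for every transition [t], and the copy belonging to [t] receives a
    large negative input unless [t] is the transition being taken.  By
    determinism at most one copy is active, so state, tops and stack codes are
    linear functions of the hidden state, and a stuck automaton has hidden state
    [0].  The tops of the new stacks are affine in the old stack codes before
    saturation, because each copy knows which symbols are popped and pushed.
    The next-symbol distribution is a linear readout as well, as each copy
    knows its target state; the projection is the identity on distributions. *)

Require Import Defs.
From HB Require Import structures.
From mathcomp Require Import all_boot all_order all_algebra.
From mathcomp Require Import ring lra.
From mathcomp Require Import boolp classical_sets functions reals esum.

Set Implicit Arguments.
Unset Strict Implicit.
Unset Printing Implicit Defensive.

Import Order.TTheory GRing.Theory Num.Theory.
Local Open Scope ring_scope.

(** * Saturation, and Cantor-set codes of stacks *)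

Lemma sat_sigmoid_le0 (x : rat) : x <= 0 -> sat_sigmoid x = 0.
Proof. by rewrite /sat_sigmoid; case: ifP => // ? ?; case: ifP; lra. Qed.

Lemma sat_sigmoid_id (x : rat) : 0 <= x <= 1 -> sat_sigmoid x = x.
Proof. by move=> /andP[? ?]; rewrite /sat_sigmoid; case: ifP; [lra|case: ifP; lra]. Qed.

Lemma sat_sigmoid_ge1 (x : rat) : 1 <= x -> sat_sigmoid x = 1.
Proof. by move=> ?; rewrite /sat_sigmoid; case: ifP; [lra|case: ifP; lra]. Qed.

(* Locked because [lra] and [field] would unfold them while reifying. *)
HB.lock Definition base (Gamma : finType) : rat := (2 * #|{: option Gamma}|)%:R.
HB.lock Definition digit (Gamma : finType) (x : option Gamma) : rat :=
  (2 * enum_rank x)%:R.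

Section StackCode.
Variable Gamma : finType.
Implicit Types (x : option Gamma) (s : seq Gamma).
Local Notation base := (base Gamma).

(* Only even digits are used, including one that marks the empty stack, so that
   the codes of stacks with different tops are separated by a gap. *)
Fixpoint stack_code s : rat :=
  if s is g :: s' then (digit (Some g) + stack_code s') / base
  else @digit Gamma None / base.

Lemma base_ge2 : 2 <= base.
Proof. by rewrite base.unlock card_option ler_nat mulnS leq_addr. Qed.

Lemma base_neq0 : base != 0.
Proof. by have := base_ge2; lra. Qed.

Lemma digit_ge0 x : 0 <= digit x.
Proof. by rewrite digit.unlock ler0n. Qed.

Lemma digit_le x : digit x + 2 <= base.
Proof. by rewrite digit.unlock base.unlock -natrD ler_nat addnC -mulnS leq_mul2l /=. Qed.

Lemma digit_lt x x' : (enum_rank x < enum_rank x')%N -> digit x + 2 <= digit x'.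
Proof. by move=> h; rewrite digit.unlock -natrD ler_nat addnC -mulnS leq_mul2l. Qed.

Lemma base_mul_stack_code g s :
  base * stack_code (g :: s) = digit (Some g) + stack_code s.
Proof. by rewrite /= mulrC divfK ?base_neq0. Qed.

Lemma stack_code_itv s : 0 <= stack_code s <= 1.
Proof.
have hB := base_ge2.
elim: s => [|g s /andP[IH0 IH1]] /=.
  have := digit_ge0 None; have := digit_le None => h1 h0.
  by rewrite divr_ge0 ?ler_pdivrMr; lra.
have := digit_ge0 (Some g); have := digit_le (Some g) => h1 h0.
by rewrite divr_ge0 ?ler_pdivrMr; lra.
Qed.

Lemma stack_code_head s :
  digit (ohead s) <= base * stack_code s <= digit (ohead s) + 1.
Proof.
case: s => [|g s]; first by rewrite /= mulrC divfK ?base_neq0 //; lra.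
by rewrite base_mul_stack_code /=; have := stack_code_itv s; lra.
Qed.

Definition threshold (x : option Gamma) (c : bool) : rat :=
  (if c then 1 else - 1) - digit x.

(** [base * stack_code s] exceeds the digit of the head by at most 1. Subtracting [digit x] leaves a
    value in [[0, 1]] if the head is [x]; otherwise, digits being at least 2 apart, it is at most -1
    or at least 2, and both sigmoids saturate at the same end. *)
Lemma threshold_sub x s :
  sat_sigmoid (base * stack_code s + threshold x true)
    - sat_sigmoid (base * stack_code s + threshold x false)
  = (ohead s == x)%:R.
Proof.
have /andP[lo hi] := stack_code_head s; rewrite /threshold.
case: (ltngtP (enum_rank (ohead s)) (enum_rank x)) => [lt|lt|/val_inj/enum_rank_inj eq].
- have := digit_lt lt => ?; have -> : (ohead s == x) = false.
    by apply/eqP => eq; rewrite eq ltnn in lt.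
  by rewrite !sat_sigmoid_le0 //; lra.
- have := digit_lt lt => ?; have -> : (ohead s == x) = false.
    by apply/eqP => eq; rewrite eq ltnn in lt.
  by rewrite !sat_sigmoid_ge1 //; lra.
- rewrite -eq eqxx sat_sigmoid_ge1 ?sat_sigmoid_le0 ?subr0 //; lra.
Qed.

Definition pop_ok x s : bool := (x == None) || (ohead s == x).

Lemma popE x s :
  pop x s = if pop_ok x s then Some (if x is Some _ then behead s else s) else None.
Proof.
by rewrite /pop_ok; case: x s => [a|] [|b s] //=; rewrite (inj_eq Some_inj) eq_sym.
Qed.

(** Popping [a] acts on codes as [v -> base * v - digit (Some a)], pushing [b] as
    [v -> (digit (Some b) + v) / base]; this is the slope of the composite. *)
Definition stack_op_slope (x y : option Gamma) : rat :=
  (if x is Some _ then base else 1) / (if y is Some _ then base else 1).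

Definition stack_op_offset (x y : option Gamma) : rat :=
  let c := if x is Some a then - digit (Some a) else 0 in
  if y is Some b then (c + digit (Some b)) / base else c.

Lemma stack_op_code x y s s' : pop x s = Some s' ->
  stack_code (push y s') = stack_op_slope x y * stack_code s + stack_op_offset x y.
Proof.
have hB := base_neq0.
have pushE r : stack_code (push y r)
    = if y is Some g then (digit (Some g) + stack_code r) / base else stack_code r.
  by case: y.
rewrite popE pushE; case: ifP => //; rewrite /pop_ok /stack_op_slope /stack_op_offset.
case: x => [a|] /= => [/eqP hs|_] [<-]; last first.
  by case: y {pushE} => [g|] /=; field.
case: s hs => // b s [->]; rewrite [behead _]/=.
have <- : base * stack_code (a :: s) - digit (Some a) = stack_code s.
  by rewrite base_mul_stack_code addrC addKr.
by case: y {pushE} => [g|]; field.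
Qed.

(** Bounds the input of copies whose transition does not apply, hence the arbitrary [v]. An upper
    bound suffices, as these inputs are to be pushed below 0. *)
Lemma stack_op_le x y (v : rat) : 0 <= v <= 1 ->
  stack_op_slope x y * v + stack_op_offset x y <= base + 1.
Proof.
have hB := base_ge2; move=> /andP[v0 v1].
rewrite /stack_op_slope /stack_op_offset.
have hx : (if x is Some _ then base else 1) * v
            + (if x is Some a then - digit (Some a) else 0) <= base.
  case: x => [a|]; last by lra.
  have bv_le : base * v <= base by rewrite ler_piMr; lra.
  by have d_ge0 := digit_ge0 (Some a); lra.
case: y => [g|]; last by rewrite divr1; apply: le_trans hx _; lra.
rewrite mulrAC -mulrDl ler_pdivrMr; last by lra.
rewrite addrA; apply: le_trans (lerD hx (lexx _)) _.
by have d_le := digit_le (Some g); nra.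
Qed.

End StackCode.

Section Simulation.
Variables (Q Sigma Gamma : finType) (P : two_pda Q Sigma Gamma).
Local Notation transition := (transition Q Sigma Gamma).
Local Notation config := (pda_config Q Gamma).
Implicit Types (c : config) (t : transition).

(** * Applicability of transitions *)

Definition stack c (b : bool) : seq Gamma := if b then c.2 else c.1.2.
Definition tpop t (b : bool) := if b then tpop2 t else tpop1 t.
Definition tpush t (b : bool) := if b then tpush2 t else tpush1 t.

Definition enabled c t : bool :=
  [&& c.1.1 != final_state P, tsrc t == c.1.1,
      ohead (stack c false) == Some (ttop t), delta P t != 0,
      pop_ok (tpop t false) (stack c false) & pop_ok (tpop t true) (stack c true)].

Lemma isSome_pda_step c t : isSome (pda_step P c t) = enabled c t.
Proof.
case: c => [[q s1] s2]; rewrite /pda_step /enabled /= (popE (tpop1 t)) (popE (tpop2 t)).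
case: (q != _) => //; case: (_ == q) => //; case: (_ == Some _) => //.
by case: (_ != 0) => //; case: pop_ok => //; case: pop_ok.
Qed.

Lemma pda_step_stack c t c' b : pda_step P c t = Some c' ->
  exists2 s, pop (tpop t b) (stack c b) = Some s & stack c' b = push (tpush t b) s.
Proof.
case: c => [[q s1] s2]; rewrite /pda_step /=; case: ifP => // _.
case E1: pop => [s1'|//]; case E2: pop => [s2'|//] [<-].
by case: b; [exists s2'|exists s1'].
Qed.

Lemma pda_step_state c t c' : pda_step P c t = Some c' -> c'.1.1 = tdst t.
Proof.
case: c => [[q s1] s2]; rewrite /pda_step /=; case: ifP => // _.
by case: pop => // s1'; case: pop => // s2' [<-].
Qed.

(** * Hidden states and their linear readouts *)

(* [None] indicates the control state, [Some (b, None)] holds the code of stack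
   [b], and the two thresholds [Some (b, Some (x, _))] differ exactly when the
   top of stack [b] is [x]. *)
Definition kind : finType := option (bool * option (option Gamma * bool)).
Implicit Types (k : kind).

Definition kind_stack k : bool := if k is Some (b, _) then b else false.

Definition kind_slope k : rat :=
  match k with
  | None => 0
  | Some (_, None) => 1
  | Some (_, Some _) => base Gamma
  end.

Definition kind_offset k : rat :=
  match k with
  | None => 1
  | Some (_, None) => 0
  | Some (_, Some (x, c)) => threshold x c
  end.

Definition feature c k : rat :=
  sat_sigmoid (kind_slope k * stack_code (stack c (kind_stack k)) + kind_offset k).

(* Neurons are replicated for each transition, since the affine map on stack
   codes depends on it; [None] holds the initial configuration. *)
Definition neuron : finType := (option transition * kind)%type.
Implicit Types (j : option transition) (n m : neuron) (w h : neuron -> rat).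

(** [j] is the transition taken last, [None] before the first step; all other copies are 0. *)
Definition encoding j c n : rat := (n.1 == j)%:R * feature c n.2.

Definition readout w h : rat := \sum_n w n * h n.

Definition target_state j : Q := if j is Some t then tdst t else init_state P.

Definition state_readout (q : Q) n : rat := ((target_state n.1 == q) && (n.2 == None))%:R.
Definition code_readout (b : bool) n : rat := (n.2 == Some (b, None))%:R.
Definition top_readout (b : bool) (x : option Gamma) n : rat :=
  (n.2 == Some (b, Some (x, true)))%:R - (n.2 == Some (b, Some (x, false)))%:R.

Lemma readoutD w w' h :
  readout (fun n => w n + w' n) h = readout w h + readout w' h.
Proof. by rewrite /readout -big_split /=; apply: eq_bigr => n _; rewrite mulrDl. Qed.

Lemma readoutZ a w h : readout (fun n => a * w n) h = a * readout w h.
Proof. by rewrite /readout mulr_sumr; apply: eq_bigr => n _; rewrite mulrA. Qed.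

Lemma readout0 h : readout (fun=> 0) h = 0.
Proof. by rewrite /readout big1 // => n _; rewrite mul0r. Qed.

Lemma readout_0 w : readout w (fun=> 0) = 0.
Proof. by rewrite /readout big1 // => n _; rewrite mulr0. Qed.

Lemma sum_indicator (I : finType) (F : I -> rat) i0 :
  \sum_i (i == i0)%:R * F i = F i0.
Proof.
by rewrite (bigD1 i0) //= eqxx mul1r big1 ?addr0 // => i /negPf ->; rewrite mul0r.
Qed.

Lemma readout_encoding w j c :
  readout w (encoding j c) = \sum_k w (j, k) * feature c k.
Proof.
transitivity (\sum_i \sum_k w (i, k) * ((i == j)%:R * feature c k)).
  by rewrite pair_bigA; apply: eq_bigr; case.
rewrite -[RHS](sum_indicator (fun i => \sum_k w (i, k) * feature c k)).
by apply: eq_bigr => i _; rewrite mulr_sumr; apply: eq_bigr => k _; rewrite mulrCA.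
Qed.

(** The control neuron of the active copy has the constant value 1. *)
Lemma state_readout_encoding q j c :
  readout (state_readout q) (encoding j c) = (target_state j == q)%:R.
Proof.
rewrite readout_encoding /state_readout /=; case: (_ == q) => /=; last first.
  by rewrite big1 // => k _; rewrite mul0r.
by rewrite sum_indicator /feature sat_sigmoid_id ?mul0r ?add0r.
Qed.

Lemma code_readout_encoding b j c :
  readout (code_readout b) (encoding j c) = stack_code (stack c b).
Proof.
rewrite readout_encoding sum_indicator /feature /= mul1r addr0.
by rewrite sat_sigmoid_id // stack_code_itv.
Qed.

Lemma top_readout_encoding b x j c :
  readout (top_readout b x) (encoding j c) = (ohead (stack c b) == x)%:R.
Proof.
rewrite readout_encoding -threshold_sub.
under eq_bigr do rewrite /top_readout mulrBl.
by rewrite sumrB !sum_indicator.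
Qed.

(** * Gates selecting the transition to fire *)

Definition pop_readout t b n : rat :=
  if tpop t b is Some g then top_readout b (Some g) n else 0.

Definition gate_readout t n : rat :=
  state_readout (tsrc t) n + top_readout false (Some (ttop t)) n
    + pop_readout t false n + pop_readout t true n.

(* The number of conditions for firing [t] that do not depend on the
   configuration and hold, minus the number 6 of all conditions. *)
Definition gate_bias t : rat :=
  (tpop t false == None)%:R + (tpop t true == None)%:R
    + ((tsrc t != final_state P) && (delta P t != 0))%:R - 6.

Definition gate h t (y : Sigma) : rat :=
  readout (gate_readout t) h + (tout t == Some y)%:R + gate_bias t.

Lemma pop_readout_encoding t b j c :
  readout (pop_readout t b) (encoding j c) + (tpop t b == None)%:R
  = (pop_ok (tpop t b) (stack c b))%:R.
Proof.
rewrite /pop_readout /pop_ok; case: (tpop t b) => [g|] /=.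
  by rewrite addr0 top_readout_encoding.
by rewrite readout0 add0r.
Qed.

Lemma readout_gate t h : readout (gate_readout t) h
  = readout (state_readout (tsrc t)) h + readout (top_readout false (Some (ttop t))) h
    + readout (pop_readout t false) h + readout (pop_readout t true) h.
Proof.
by rewrite /readout -!big_split; apply: eq_bigr => n _; rewrite !mulrDl.
Qed.

(** The gate is the number of conditions that hold minus 6, where a non-final source and a nonzero
    weight count as one condition. Being an integer, it is 0 or at most -1. *)
Lemma gate_encoding j c t y : target_state j = c.1.1 ->
  if enabled c t && (tout t == Some y) then gate (encoding j c) t y = 0
  else gate (encoding j c) t y <= -1.
Proof.
move=> hj; rewrite /gate /gate_bias readout_gate.
rewrite state_readout_encoding top_readout_encoding hj.
have := pop_readout_encoding t false j c; have := pop_readout_encoding t true j c.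
move: (readout _ _) (readout _ _) (tpop t false == _) (tpop t true == _).
move=> r1 r2 b1 b2 e2 e1; rewrite /enabled [tsrc t == _]eq_sym.
(* [gate_bias] tests whether [tsrc t] is final, [enabled] whether the current state is; the tests
   agree once the two states coincide. *)
have -> : (c.1.1 != final_state P) && [&& c.1.1 == tsrc t,
      ohead (stack c false) == Some (ttop t), delta P t != 0,
      pop_ok (tpop t false) (stack c false) & pop_ok (tpop t true) (stack c true)]
    = [&& c.1.1 == tsrc t, ohead (stack c false) == Some (ttop t),
      (tsrc t != final_state P) && (delta P t != 0),
      pop_ok (tpop t false) (stack c false) & pop_ok (tpop t true) (stack c true)].
  by case: (c.1.1 =P tsrc t) => [->|_]; rewrite ?andbF // andbCA andbA; do !case: (_ == _).
move: (c.1.1 == _) (_ == Some (ttop t)) (_ && (_ != 0)) (_ == Some y) => d1 d2 d3 d4.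
move: (pop_ok _ _) (pop_ok _ _) e1 e2 => d5 d6 e1 e2.
have -> : forall x y z : rat, x + r1 + r2 + y + (b1%:R + b2%:R + z - 6)
   = x + y + (r1 + b1%:R) + (r2 + b2%:R) + z - 6 by move=> *; ring.
rewrite e1 e2 {e1 e2}.
by case: d1; case: d2; case: d3; case: d4; case: d5; case: d6.
Qed.

(** * One step of the recurrence *)

(** Slopes are at most [base Gamma], updated codes at most [base Gamma + 1] and offsets at most 1,
    so a gate of at most -1 makes the total input nonpositive. *)
Definition penalty : rat := base Gamma * (base Gamma + 1) + 1.

Lemma kind_arg_le k (v : rat) : v <= base Gamma + 1 ->
  kind_slope k * v + kind_offset k <= penalty.
Proof.
have hB := base_ge2 Gamma; move=> hv; rewrite /penalty.
have hB2 : base Gamma + 1 <= base Gamma * (base Gamma + 1) by rewrite ler_peMl; lra.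
case: k => [[b [[x c]|]]|] /=; [|lra|lra].
have hx : threshold x c <= 1.
  by rewrite /threshold; have := digit_ge0 x; case: c => ?; lra.
by apply: lerD => //; rewrite ler_pM2l //; lra.
Qed.

(** The row of the initial copy is 0, as is its [drive], so that copy is silent after one step. *)
Definition recurrent n m : rat :=
  if n.1 is Some t then
    let b := kind_stack n.2 in
    kind_slope n.2 * stack_op_slope (tpop t b) (tpush t b) * code_readout b m
      + penalty * gate_readout t m
  else 0.

Definition drive (y : Sigma) n : rat :=
  if n.1 is Some t then
    let b := kind_stack n.2 in
    kind_slope n.2 * stack_op_offset (tpop t b) (tpush t b) + kind_offset n.2
      + penalty * ((tout t == Some y)%:R + gate_bias t)
  else 0.

Definition next_hidden h (y : Sigma) n : rat :=
  sat_sigmoid (readout (recurrent n) h + drive y n).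

Lemma next_hiddenE h y t k (b := kind_stack k) :
  next_hidden h y (Some t, k) = sat_sigmoid (kind_slope k
      * (stack_op_slope (tpop t b) (tpush t b) * readout (code_readout b) h
         + stack_op_offset (tpop t b) (tpush t b))
      + kind_offset k + penalty * gate h t y).
Proof.
rewrite /next_hidden /recurrent /drive /= readoutD !readoutZ /gate -/b; congr sat_sigmoid.
ring.
Qed.

Lemma next_hidden_None h y k : next_hidden h y (None, k) = 0.
Proof. by rewrite /next_hidden /recurrent /drive /= readout0 sat_sigmoid_le0. Qed.

(** Stated for any [h] with code readouts in [[0, 1]], to cover the zero state along with
    encodings. *)
Lemma next_hidden_silent h y t k :
  (forall b, 0 <= readout (code_readout b) h <= 1) -> gate h t y <= -1 ->
  next_hidden h y (Some t, k) = 0.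
Proof.
move=> hcode hgate; rewrite next_hiddenE sat_sigmoid_le0 //.
have := kind_arg_le k (stack_op_le (tpop t (kind_stack k)) (tpush t (kind_stack k))
  (hcode (kind_stack k))).
have pen_gt0 : 0 < penalty.
  by have := base_ge2 Gamma; rewrite /penalty => ?; rewrite ltr_wpDl // mulr_ge0; lra.
have : penalty * gate h t y <= - penalty by rewrite -mulrN1 ler_pM2l.
by move=> h1 h2; lra.
Qed.

Lemma code_readout_encoding_itv j c b :
  0 <= readout (code_readout b) (encoding j c) <= 1.
Proof. by rewrite code_readout_encoding stack_code_itv. Qed.

(** The gate of [t] is 0, so its copy computes the features of the new stacks, while all other
    copies are silent. *)
Lemma next_hidden_step j c t y c' : pda_deterministic P ->
  target_state j = c.1.1 -> tout t = Some y -> pda_step P c t = Some c' ->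
  next_hidden (encoding j c) y =1 encoding (Some t) c'.
Proof.
move=> [det _] hj ty step [[t'|] k]; last by rewrite next_hidden_None /encoding mul0r.
have en : enabled c t by rewrite -isSome_pda_step step.
have hg := gate_encoding t' y hj; rewrite /encoding /= (inj_eq Some_inj).
case: (t' =P t) hg => [->|net] hg.
  rewrite en ty eqxx /= in hg; rewrite next_hiddenE hg mulr0 addr0 code_readout_encoding.
  rewrite mul1r /feature; have [s pops ->] := pda_step_stack (kind_stack k) step.
  by rewrite (stack_op_code _ pops).
rewrite mul0r next_hidden_silent //; first exact: code_readout_encoding_itv.
(* An enabled [t'] emitting [y] would share source, top and output with [t], and so equal it by
   determinism. *)
suff /negPf e : ~~ (enabled c t' && (tout t' == Some y)) by rewrite e in hg.
apply: contra_notN net => /andP[en' /eqP ty'].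
move: en en' => /and5P[_ /eqP s1 /eqP o1 d1 _] /and5P[_ /eqP s2 /eqP o2 d2 _].
by apply: det => //; [rewrite s1|move: o1; rewrite o2 => -[]|rewrite ty].
Qed.

Lemma next_hidden_stuck j c y : target_state j = c.1.1 ->
  (forall t, tout t = Some y -> pda_step P c t = None) ->
  next_hidden (encoding j c) y =1 (fun=> 0).
Proof.
move=> hj stuck [[t|] k]; last by rewrite next_hidden_None.
rewrite next_hidden_silent //; first exact: code_readout_encoding_itv.
have := gate_encoding t y hj; rewrite -isSome_pda_step.
by case: (tout t =P Some y) => [/stuck ->|]; rewrite ?andbF.
Qed.

(** With all readouts 0, at most four of the six conditions can count, so every gate is at most
    -2. *)
Lemma next_hidden_0 y : next_hidden (fun=> 0) y =1 (fun=> 0).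
Proof.
move=> [[t|] k]; last by rewrite next_hidden_None.
rewrite next_hidden_silent // => [b|]; first by rewrite readout_0 lexx ler01.
rewrite /gate readout_0 add0r /gate_bias.
have le1 (b : bool) : b%:R <= 1 :> rat by case: b.
have := le1 (tout t == Some y); have := le1 (tpop t false == None).
have := le1 (tpop t true == None).
have := le1 ((tsrc t != final_state P) && (delta P t != 0)).
by lra.
Qed.

(** * Next-symbol distribution *)

(** [None] is EOS for [o] but the empty string for [tout t]; the real-time condition makes the sum
    for [None] vanish. Transitions whose pops fail keep their weight, and the symbol they emit leads
    to the stuck state. *)
Definition output_prob (q : Q) (x : option Gamma) (o : option Sigma) : rat :=
  if q == final_state P then (o == None)%:R
  else if x is Some g then
    \sum_(t | [&& tsrc t == q, ttop t == g & tout t == o]) delta P t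
  else 0.

Definition output_readout (o : option Sigma) n : rat :=
  \sum_x output_prob (target_state n.1) x o * top_readout false x n.

Lemma output_readout_encoding o j c : target_state j = c.1.1 ->
  readout (output_readout o) (encoding j c)
  = output_prob c.1.1 (ohead (stack c false)) o.
Proof.
move=> <-.
transitivity (\sum_x output_prob (target_state j) x o
                * readout (top_readout false x) (encoding j c)).
  rewrite readout_encoding /output_readout /=.
  under eq_bigr do rewrite mulr_suml.
  rewrite exchange_big /=; apply: eq_bigr => x _.
  by rewrite readout_encoding mulr_sumr; apply: eq_bigr => k _; rewrite mulrA.
under eq_bigr do rewrite top_readout_encoding mulrC eq_sym.
by rewrite sum_indicator.
Qed.

Lemma output_prob_ge0 q x o : 0 <= output_prob q x o.
Proof.
rewrite /output_prob; case: ifP => // _; case: x => // g.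
by apply: sumr_ge0 => t _; apply: delta_ge0.
Qed.

Lemma output_prob_sum1 q x : (q == final_state P) || (x != None) ->
  \sum_o output_prob q x o = 1.
Proof.
rewrite /output_prob; case: (q == _) => /= [_|].
  by rewrite (bigD1 None) //= big1 ?addr0 // => o /negPf ->.
case: x => // g _; rewrite -(delta_normalized P q g).
rewrite [RHS](partition_big (@tout _ _ _) xpredT) //=.
by apply: eq_bigr => o _; apply: eq_bigl => t; rewrite andbA.
Qed.

Lemma output_prob_step c t c' : pda_deterministic P -> pda_step P c t = Some c' ->
  output_prob c.1.1 (ohead (stack c false)) (tout t) = delta P t.
Proof.
move=> [det _] step.
have : enabled c t by rewrite -isSome_pda_step step.
move=> /and5P[/negPf nf /eqP st /eqP ot dt _]; rewrite /output_prob nf ot.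
rewrite (bigD1 t) /= ?st ?eqxx // big1 ?addr0 // => t'.
case/andP=> /and3P[/eqP s1 /eqP o1 /eqP u1] /eqP ne; apply/eqP; apply: contra_notT ne.
by move=> dt'; apply: det => //; rewrite s1.
Qed.

Lemma output_prob_None c : pda_real_time P ->
  output_prob c.1.1 (ohead (stack c false)) None
  = (c.1.1 == final_state P)%:R.
Proof.
move=> rt; rewrite /output_prob; case: ifP => // _; case: ohead => // g.
by rewrite big1 // => t /and3P[_ _ /eqP/rt].
Qed.

(** * The simulating RLM *)

Definition hidden_vector h : 'cV[rat]_#|{: neuron}| := \col_i h (enum_val i).

Lemma eq_hidden_vector h h' : h =1 h' -> hidden_vector h = hidden_vector h'.
Proof. by move=> eqh; apply/colP => i; rewrite !mxE eqh. Qed.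

Lemma readout_enum_val w h :
  \sum_(i < #|{: neuron}|) w (enum_val i) * h (enum_val i) = readout w h.
Proof. by rewrite -(big_enum_val (fun n => w n * h n)). Qed.

Variables (R : realType) (y0 : Sigma).
Local Notation outputs := #|{: option Sigma}|.

Definition is_distribution (v : 'cV[rat]_outputs) : bool :=
  [forall i, 0 <= v i 0] && (\sum_i v i 0 == 1).

(* A stuck automaton is simulated by generating [y0] forever. *)
Definition simulation_proj (v : 'cV[rat]_outputs) : 'cV[R]_outputs :=
  if is_distribution v then map_mx ratr v else delta_mx (enum_rank (Some y0)) 0.

Lemma simulation_proj_ge0 v i : 0 <= simulation_proj v i 0.
Proof.
rewrite /simulation_proj; case: ifP => [/andP[/forallP v_ge0 _]|_].
  by rewrite mxE ler0q.
by rewrite mxE ler0n.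
Qed.

Lemma simulation_proj_sum1 v : \sum_i simulation_proj v i 0 = 1.
Proof.
rewrite /simulation_proj; case: ifP => [/andP[_ /eqP v_sum1]|_].
  by under eq_bigr do rewrite mxE; rewrite -rmorph_sum v_sum1 rmorph1.
rewrite (bigD1 (enum_rank (Some y0))) //= big1 ?mxE ?eqxx ?addr0 // => i /negPf ne.
by rewrite mxE ne.
Qed.

(** The embedding of [y] already contains the bias, whence the identity [rnn_V] and zero [rnn_b]. *)
Definition simulation_rlm : rlm R Sigma :=
  {| rnn_h0 := hidden_vector (encoding None (pda_init P));
     rnn_r := fun y => hidden_vector (drive y);
     rnn_U := \matrix_(i, k) recurrent (enum_val i) (enum_val k);
     rnn_V := 1%:M;
     rnn_b := 0;
     rlm_E := \matrix_(i, k) output_readout (enum_val i) (enum_val k);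
     rlm_proj_ge0 := simulation_proj_ge0;
     rlm_proj_sum1 := simulation_proj_sum1 |}.

Local Notation update := (@rnn_update R Sigma simulation_rlm).
Local Notation next_prob := (@rlm_next_prob R Sigma simulation_rlm).
Local Notation halting_from := (@rlm_halting_from R Sigma simulation_rlm).
Local Notation weight_from := (@rlm_weight_from R Sigma simulation_rlm).

Lemma rnn_update_simulation h y :
  update (hidden_vector h) y = hidden_vector (next_hidden h y).
Proof.
apply/colP => i; rewrite /rnn_update /= addr0 mul1mx !mxE /next_hidden.
by congr (sat_sigmoid (_ + _)); under eq_bigr do rewrite !mxE; apply: readout_enum_val.
Qed.

Lemma simulation_logits h : rlm_E simulation_rlm *m hidden_vector h
  = \col_i readout (output_readout (enum_val i)) h.
Proof.
by apply/colP => i; rewrite !mxE; under eq_bigr do rewrite !mxE; apply: readout_enum_val.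
Qed.

(** In the fallback branch of the projection, all mass lies on [Some y0], which is not EOS. *)
Lemma rlm_next_prob_eos_eq0 h : readout (output_readout None) h = 0 ->
  next_prob (hidden_vector h) None = 0.
Proof.
move=> h0; rewrite /rlm_next_prob simulation_logits /= /simulation_proj.
case: ifP => _; first by rewrite !mxE enum_rankK h0 rmorph0.
by rewrite mxE (inj_eq enum_rank_inj).
Qed.

Lemma rlm_next_prob_encoding j c o : target_state j = c.1.1 ->
  (c.1.1 == final_state P) || (ohead (stack c false) != None) ->
  next_prob (hidden_vector (encoding j c)) o
  = ratr (output_prob c.1.1 (ohead (stack c false)) o).
Proof.
move=> hj hc; rewrite /rlm_next_prob simulation_logits /= /simulation_proj.
rewrite ifT ?mxE ?enum_rankK ?output_readout_encoding //.
apply/andP; split.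
  by apply/forallP => i; rewrite mxE output_readout_encoding // output_prob_ge0.
under eq_bigr do rewrite mxE output_readout_encoding //.
by rewrite -(big_enum_val (output_prob _ _)) /= output_prob_sum1.
Qed.

(** * Correspondence of halting paths *)

Hypothesis RD : is_RD_2PDA P.

Definition eos_path (p : seq transition) : seq (option Sigma) :=
  rcons (map (@tout _ _ _) p) None.

Definition run_halts c p : bool :=
  if pda_run P c p is Some c' then c'.1.1 == final_state P else false.

Lemma rlm_halting_stuck (ys : seq (option Sigma)) :
  ~~ halting_from (hidden_vector (fun=> 0)) ys.
Proof.
elim: ys => // -[y|] ys IH /=.
  by rewrite rnn_update_simulation (eq_hidden_vector (next_hidden_0 y)) (negPf IH) andbF.
by rewrite rlm_next_prob_eos_eq0 ?readout_0 ?eqxx.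
Qed.

Lemma real_time_step c t c' : pda_step P c t = Some c' -> exists y, tout t = Some y.
Proof.
move=> step; have : enabled c t by rewrite -isSome_pda_step step.
case/and5P=> _ _ _ dt _; case ty: (tout t) => [y|]; first by exists y.
by rewrite (RD.2 _ ty) eqxx in dt.
Qed.

Lemma pda_step_nonempty c t c' : pda_step P c t = Some c' ->
  (c.1.1 == final_state P) || (ohead (stack c false) != None).
Proof.
move=> step; have : enabled c t by rewrite -isSome_pda_step step.
by case/and5P => _ _ /eqP ->; rewrite orbT.
Qed.

Lemma rlm_simulates_run p j c : target_state j = c.1.1 -> run_halts c p ->
  halting_from (hidden_vector (encoding j c)) (eos_path p)
  /\ weight_from (hidden_vector (encoding j c)) (eos_path p) = ratr (pda_weight P p).
Proof.
elim: p j c => [|t p IH] j c hj; rewrite /run_halts /=.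
  move=> final; rewrite rlm_next_prob_encoding ?final // output_prob_None; last exact: RD.2.
  by rewrite final rmorph1 oner_eq0 /pda_weight big_nil rmorph1.
case step: (pda_step P c t) => [c'|//] halts.
have [y ty] := real_time_step step.
have [IHh IHw] := IH (Some t) c' (esym (pda_step_state step)) halts.
rewrite ty /= rnn_update_simulation (eq_hidden_vector (next_hidden_step RD.1 hj ty step)).
rewrite rlm_next_prob_encoding ?(pda_step_nonempty step) // -ty.
rewrite (output_prob_step RD.1 step) /pda_weight big_cons rmorphM /= -/(pda_weight P p) -IHw.
split=> //; apply/andP; split=> //; rewrite fmorph_eq0.
have : enabled c t by rewrite -isSome_pda_step step.
by case/and5P.
Qed.

(** A symbol emitted by no applicable transition leads to the zero hidden state, from which no path
    halts; so each symbol of a halting path comes from a transition. *)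
Lemma rlm_run_simulated ys j c : target_state j = c.1.1 ->
  halting_from (hidden_vector (encoding j c)) ys ->
  exists2 p, run_halts c p & eos_path p = ys.
Proof.
elim: ys j c => // -[y|] ys IH j c hj /=; last first.
  case/andP => prob /eqP ->; exists [::] => //; rewrite /run_halts /=.
  (* Outside the final state the EOS logit is 0 by the real-time condition. *)
  apply: contra_neqT prob => nf; apply: rlm_next_prob_eos_eq0.
  by rewrite output_readout_encoding // output_prob_None ?(negPf nf) //; exact: RD.2.
case/andP => _; rewrite rnn_update_simulation.
case: (pselect (exists2 t, tout t = Some y & pda_step P c t <> None)); last first.
  move=> none; rewrite (eq_hidden_vector (next_hidden_stuck hj _)).
    by rewrite (negPf (rlm_halting_stuck ys)).
  by move=> t ty; apply: contrapT => ne; apply: none; exists t.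
move=> [t ty]; case step: (pda_step P c t) => [c'|//] _.
rewrite (eq_hidden_vector (next_hidden_step RD.1 hj ty step)) => halts.
have [p run <-] := IH (Some t) c' (esym (pda_step_state step)) halts.
by exists (t :: p); rewrite /run_halts /eos_path /= ?step ?ty.
Qed.

(** From a common configuration, equal outputs force equal transitions by determinism, hence a
    common next configuration. *)
Lemma eos_path_inj p p' c : run_halts c p -> run_halts c p' ->
  eos_path p = eos_path p' -> p = p'.
Proof.
elim: p p' c => [|t p IH] [|t' p'] c //.
- by move=> _ _ /(congr1 size); rewrite !size_rcons.
- by move=> _ _ /(congr1 size); rewrite !size_rcons.
rewrite /run_halts /eos_path /=.
case step: (pda_step P c t) => [c1|//] halts.
case step': (pda_step P c t') => [c1'|//] halts'.
case=> eqt eqp; have ett' : t = t'.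
  have : enabled c t by rewrite -isSome_pda_step step.
  have : enabled c t' by rewrite -isSome_pda_step step'.
  move=> /and5P[_ /eqP s1 /eqP o1 d1 _] /and5P[_ /eqP s2 /eqP o2 d2 _].
  by apply: RD.1.1 => //; [rewrite s1|move: o1; rewrite o2 => -[]].
rewrite -ett' step in step'; case: step' halts' => <- halts'.
by rewrite -ett' (IH p' c1).
Qed.

Lemma eos_path_yield p : rlm_yield (eos_path p) = pda_yield p.
Proof.
by rewrite /rlm_yield /eos_path /pda_yield; elim: p => //= t p ->; case: (tout t).
Qed.

Lemma pda_haltingE p :
  pda_halting P p = run_halts (pda_init P) p.
Proof. by rewrite /pda_halting /run_halts /pda_init; case: pda_run => [[[]]|]. Qed.

Lemma eos_path_bij : set_bij (@lm_halting _ _ (lm_of_pda P R))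
  (@lm_halting _ _ (lm_of_rlm simulation_rlm)) eos_path.
Proof.
split=> [p|p p'|ys] /=.
- by rewrite pda_haltingE => /(rlm_simulates_run (j := None)) [].
- by rewrite !inE /= !pda_haltingE; apply: eos_path_inj.
- case/(rlm_run_simulated (j := None)) => // p halts <-; exists p => //=.
  by rewrite pda_haltingE.
Qed.

End Simulation.

(** * From the path bijection to strong equivalence *)

(** The bijection restricts to the halting paths of each yield, so string probabilities agree by
    reindexing. *)
Lemma strongly_equivalent_bij (R : realType) (Sigma : finType)
    (M1 M2 : language_model R Sigma) (f : lm_path M1 -> lm_path M2) :
  set_bij (@lm_halting _ _ M1) (@lm_halting _ _ M2) f ->
  (forall p, @lm_halting _ _ M1 p ->
     lm_weight (f p) = lm_weight p /\ lm_yield (f p) = lm_yield p) ->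
  strongly_equivalent M1 M2.
Proof.
move=> [f_fun f_inj f_surj] f_ok; split; last by exists f.
move=> y; rewrite /string_prob [RHS](reindex_esum
  [set p | @lm_halting _ _ M1 p /\ lm_yield p = y]%classic _ f) /=.
  by apply: eq_esum => p [/f_ok[-> _] _].
split=> [p [hp yp]|p p'|q [hq yq]] /=.
- by split; [apply: f_fun|rewrite (f_ok p hp).2].
- rewrite !inE /= => -[hp _] [hp' _]; apply: f_inj; rewrite inE //.
- by have [p hp fp] := f_surj q hq; exists p => //=; split=> //; rewrite -(f_ok p hp).2 fp.
Qed.

Unset Implicit Arguments.

Theorem corollary4p1 (R : realType) (Q Sigma Gamma : finType)
    (hSigma : (0 < #|Sigma|)%N) (P : two_pda Q Sigma Gamma) :
  is_RD_2PDA P ->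
  exists M : rlm R Sigma, strongly_equivalent (lm_of_pda P R) (lm_of_rlm M).
Proof.
have [y0 _] := card_gt0P hSigma.
move=> RD; exists (simulation_rlm P R y0).
apply: (strongly_equivalent_bij (eos_path_bij R y0 RD)) => p; rewrite /= pda_haltingE.
by move=> /(rlm_simulates_run R y0 RD (j := None)) [] // _ ->; rewrite eos_path_yield.
Qed.
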